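(* Let $k,m$ be positive integers and let $\mu\in S(k)$. Let $\mathbf{p}=(p_1,\ldots,p_m)$ and $\mathbf{q}=(q_1,\ldots,q_m)$ be sequences of positive integers with $q_1\ge q_2\ge\cdots\ge q_m$, and suppose $n:=\sum_{i=1}^m p_iq_i\ge k$. Then $$\widehat{\chi}_{\mathbf{p}\times\mathbf{q}}(\mu)=(-1)^k\sum_{(\sigma,\varphi)\in S(k)^{(m)}}\left(\prod_{b\in C(\sigma)}p_{\varphi(b)}\ \prod_{c\in C(\sigma\mu)}\bigl(-q_{\psi(c)}\bigr)\right),$$ where, for each $(\sigma,\varphi)\in S(k)^{(m)}$, the function $\psi:C(\sigma\mu)\to\{1,\ldots,m\}$ is defined by $\psi(c)=\max_{a\in c}\varphi(a)$.
   Context: $S(k)$ is the group of permutations of $\{1,\ldots,k\}$, with product $(\sigma\mu)(a)=\sigma(\mu(a))$. For $k\le n$, $S(k)$ is embedded in $S(n)$ as the permutations fixing $k+1,\ldots,n$. For a permutation $\sigma\in S(k)$, $C(\sigma)$ denotes the set partition of $\{1,\ldots,k\}$ into the supports of the cycles of $\sigma$ (fixed points counted as cycles of length one). For a partition $\lambda$ of $n$, $\chi_\lambda$ denotes the character of the irreducible complex representation of $S(n)$ canonically indexed by $\lambda$. For $\mu\in S(k)$ and $\lambda\vdash n$ with $n\ge k$, the normalised character is $$\widehat{\chi}_\lambda(\mu)=\frac{n(n-1)\cdots(n-k+1)\,\chi_\lambda(\mu)}{\chi_\lambda(\mathrm{Id}_n)},$$ where in $\chi_\lambda(\mu)$ the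 permutation $\mu$ is identified with its image in $S(n)$. For $\mathbf{p},\mathbf{q}$ as in the claim, $\mathbf{p}\times\mathbf{q}$ is the partition of $\sum_i p_iq_i$ whose first $p_1$ parts equal $q_1$, next $p_2$ parts equal $q_2$, and so on, with the last $p_m$ nonzero parts equal to $q_m$; that is, $(\mathbf{p}\times\mathbf{q})_i=q_j$ if $p_1+\cdots+p_{j-1}+1\le i\le p_1+\cdots+p_j$, and $(\mathbf{p}\times\mathbf{q})_i=0$ if $i>p_1+\cdots+p_m$. $S(k)^{(m)}$ is the set of coloured permutations, i.e. of pairs $(\sigma,\varphi)$ with $\sigma\in S(k)$ and $\varphi:C(\sigma)\to\{1,\ldots,m\}$ an arbitrary function; $\varphi$ is also viewed as the function $\{1,\ldots,k\}\to\{1,\ldots,m\}$, constant on the cycles of $\sigma$, sending $a$ to $\varphi$ of the cycle containing $a$. *)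

(* Defs.v *)
(* In MathComp the product of permutations is read from left to right,
   (s * t) a = t (s a), so the composite a |-> s (t a) is written t * s. *)
From HB Require Import structures.
From mathcomp Require Import all_boot all_order all_algebra.
From mathcomp Require Import all_fingroup all_solvable all_field all_character.

Set Implicit Arguments.
Unset Strict Implicit.
Unset Printing Implicit Defensive.

Import GRing.Theory.
Local Open Scope ring_scope.

(* Partitions are listed without trailing zeros. *)
Definition is_partition (n : nat) (la : seq nat) : bool :=
  [&& sorted geq la, 0%N \notin la & sumn la == n].

(* The tableau used for la |- n fills the rows of the diagram successively with
   0, ..., n-1: the entry a lies in row [reshape_index la a] and in column
   [reshape_offset la a]. *)
Definition row_stab (n : nat) (la : seq nat) : {set 'S_n} :=
  [set s : 'S_n |
    [forall a : 'I_n, reshape_index la (s a) == reshape_index la a]].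

Definition col_stab (n : nat) (la : seq nat) : {set 'S_n} :=
  [set s : 'S_n |
    [forall a : 'I_n, reshape_offset la (s a) == reshape_offset la a]].

(* The Young symmetrizer, i.e. the sum of sgn(t) (s o t) over s in the row group
   and t in the column group, as an element of the group algebra C[S(n)]
   (row vectors over the basis S(n)). *)
Definition young_symmetrizer (n : nat) (la : seq nat) :
    'rV[algC]_#|[set: 'S_n]%G| :=
  \sum_(s in row_stab n la) \sum_(t in col_stab n la)
    (-1) ^+ t *: delta_mx 0 (gring_index [set: 'S_n]%G (t * s)%g).

(* The Specht module C[S(n)] c_la. The regular representation sends e_x to
   e_(x * g) = e_(g o x): with respect to composition this is left translation
   by g, and the cyclic module below is the left ideal generated by the Young
   symmetrizer. *)
Definition specht_mx (n : nat) (la : seq nat) :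
    'M[algC]_#|[set: 'S_n]%G| :=
  cyclic_mx (regular_repr algC [set: 'S_n]%G) (young_symmetrizer n la).

Lemma specht_mx_module (n : nat) (la : seq nat) :
  mxmodule (regular_repr algC [set: 'S_n]%G) (specht_mx n la).
Proof. exact: cyclic_mx_module. Qed.

(* For la |- n, the irreducible character chi_la; the one-row partition gives
   the trivial character. Complex characters of finite groups take
   their values in the algebraic numbers algC. Not meaningful unless [is_partition n la]. *)
Definition specht_char (n : nat) (la : seq nat) : 'CF([set: 'S_n]%G) :=
  cfRepr (submod_repr (specht_mx_module n la)).

Definition embed_fun (k n : nat) (lekn : (k <= n)%N) (s : 'S_k) (a : 'I_n) :
    'I_n :=
  if insub (val a) is Some b then widen_ord lekn (s b) else a.

Lemma embed_fun_inj (k n : nat) (lekn : (k <= n)%N) (s : 'S_k) :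
  injective (embed_fun lekn s).
Proof.
move=> a b; rewrite /embed_fun.
case: insubP => [a' _ Ea | ka]; case: insubP => [b' _ Eb | kb] // E.
- have /perm_inj Eab : s a' = s b' by apply/val_inj; exact: (congr1 val E).
  by apply/val_inj; rewrite /= -Ea -Eb Eab.
- by move: kb; rewrite -E /= ltn_ord.
- by move: ka; rewrite E /= ltn_ord.
Qed.

Definition embed_perm (k n : nat) (lekn : (k <= n)%N) (s : 'S_k) : 'S_n :=
  perm (@embed_fun_inj k n lekn s).

Definition normalised_char (k n : nat) (lekn : (k <= n)%N) (la : seq nat)
    (mu : 'S_k) : algC :=
  (n ^_ k)%:R * specht_char n la (embed_perm lekn mu) / specht_char n la 1%g.

Definition rect_part (m : nat) (p q : m.-tuple nat) : seq nat :=
  flatten [seq nseq (tnth p i) (tnth q i) | i <- enum 'I_m].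

Lemma rect_part_is_partition (m : nat) (p q : m.-tuple nat) :
  (forall i : 'I_m, (0 < tnth q i)%N) ->
  (forall i j : 'I_m, (i <= j)%N -> (tnth q j <= tnth q i)%N) ->
  is_partition (\sum_(i < m) tnth p i * tnth q i)%N (rect_part p q).
Proof.
move=> q_gt0 q_dec; apply/and3P; split.
- have geq_tr : transitive geq by move=> x y z /= yx xz; exact: leq_trans xz yx.
  have: sorted (fun i j : 'I_m => (i <= j)%N) (enum 'I_m).
    by have := iota_sorted 0 m; rewrite -val_enum_ord sorted_map.
  rewrite /rect_part; elim: (enum 'I_m) => //= i s IH pth.
  have leT : transitive (fun i j : 'I_m => (i <= j)%N).
    by move=> x y z; exact: leq_trans.
  move: (pth); rewrite path_sortedE // => /andP[/allP lei srt].
  rewrite sorted_pairwise // pairwise_cat -!sorted_pairwise // IH // andbT.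
  apply/andP; split.
    apply/allrelP => x y /nseqP[-> _] /flattenP[t /mapP[j /lei ij ->]].
    by case/nseqP=> -> _; exact: q_dec.
  by elim: (tnth p i) => //= c; case: c => //= c ->; rewrite leqnn.
- apply/negP => /flattenP[t /mapP[j _ ->]] /nseqP[E _].
  by have := q_gt0 j; rewrite -E.
- rewrite /rect_part sumn_flatten -map_comp sumnE big_map big_enum /=.
  by apply/eqP/eq_bigr => i _; rewrite sumn_nseq mulnC.
Qed.

(* The type of cycles of s, i.e. of blocks of C(s). *)
Definition cycle_of (k : nat) (s : 'S_k) : finType :=
  {b : {set 'I_k} | b \in porbits s}.

Definition cycle_at (k : nat) (s : 'S_k) (a : 'I_k) : cycle_of s :=
  exist _ (porbit s a) (imset_f (porbit s) (isT : a \in predT)).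

Definition coloured_perm (k m : nat) : finType :=
  {s : 'S_k & {ffun cycle_of s -> 'I_m}}.

Definition point_colour (k m : nat) (sphi : coloured_perm k m) (a : 'I_k) :
    'I_m :=
  tagged sphi (cycle_at (tag sphi) a).

(* psi(c); a number smaller than m as soon as 0 < m. *)
Definition top_colour (k m : nat) (sphi : coloured_perm k m)
    (c : {set 'I_k}) : nat :=
  \max_(a in c) point_colour sphi a.

(* Main.v *)
Require Import Defs.
From HB Require Import structures.
From mathcomp Require Import all_boot all_order all_algebra.
From mathcomp Require Import all_fingroup all_solvable all_field all_character.

Import GRing.Theory Num.Theory.
Local Open Scope ring_scope.

(** The Specht module is the image of x |-> c * x, where c is the Young
symmetrizer, the sum of sgn(t) t * s over s in the row group R and t in the
column group C. Von Neumann's argument ([sandwich_collinear]) shows that c is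
quasi-idempotent, c^2 = a c, so multiplication by a^-1 c is a projection onto
the module, and traces on the module are traces on the whole group algebra
([mxtrace_submod]). Reading the latter in the basis of permutations gives
([specht_char_ratio])
  chi(g) / chi(1) = 1/n! * sum over y and over t * s = g ^ y of sgn(t).
A point fixed by g is sent by y to a cell that both s and t must fix: t keeps
it in its column, and s, which has to bring it back, keeps it in its row. Hence
for g coming from S(k) the factorization takes place in S(k), and what remains
of y is an injection f of the k points into the diagram; the number of y above
each f turns 1/n! into the inverse of n(n-1)...(n-k+1). The normalised
character is therefore a signed count of factorizations t * u^-1 = mu together
with an injective filling f such that u preserves the rows of f and t its
columns.

Injectivity can be dropped ([filling_sum_eq0]): when f takes the same value at
x and y, multiplying u by the transposition (x y) is a sign reversing
involution. For fixed u, arbitrary fillings are easy to count, since their row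
and column coordinates are only linked by the requirement that each cell lies
in the diagram. First choose rows, constant on the cycles of u; then, on each
cycle of t = mu * u, choose a column that exists in all the rows met by that
cycle. For a multirectangular diagram the rows of colour i are p_i in number
and have length q_i; so only the colours of the rows matter for the second
choice, which can be made in q_i ways where i is the largest colour on the
cycle, the lengths q_i being nonincreasing. This is the announced product, and
sgn(t) = (-1)^(k - number of cycles of t) accounts for the signs
([count_fillings_rect]). *)

Set Implicit Arguments.
Unset Strict Implicit.

(** * Traces on the image of a quasi-idempotent *)

(** The factors W and B of L through its row space satisfy B *m W = a%:M, by
quasi-idempotency; moving W around the trace then exchanges the action on the
whole space for the action on the row space. In particular \tr L is a times
the dimension, so a is nonzero as soon as \tr L is. *)
Lemma mxtrace_submod (F : fieldType) (gT : finGroupType) (G : {group gT})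
    (d : nat) (rG : mx_representation F G d) (U : 'M[F]_d)
    (Umod : mxmodule rG U) (L : 'M[F]_d) (a : F) (x : gT) :
  (U :=: L)%MS -> L *m L = a *: L -> x \in G ->
  \tr (L *m rG x) = a * \tr (submod_repr Umod x).
Proof.
move=> eqUL LL Gx; pose B := row_base U; pose W := in_submod U L.
have defL : W *m B = L by apply: in_submodK; rewrite eqUL.
have BL : B *m L = a *: B.
  have /submxP[X ->] : (B <= L)%MS by rewrite -eqUL eq_row_base.
  by rewrite -mulmxA LL scalemxAr.
have BW : B *m W = a%:M.
  apply: (@val_submod_inj _ _ U); rewrite /val_submod /= -/B -mulmxA defL BL.
  by rewrite mul_scalar_mx.
have BG : B *m rG x = submod_mx Umod x *m B.
  by have := val_submodJ Umod 1%:M Gx; rewrite /val_submod /= !mul1mx.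
rewrite -defL -mulmxA mxtrace_mulC BG -mulmxA BW mxtrace_mulC mul_scalar_mx.
by rewrite mxtraceZ.
Qed.

(** * Extending permutations of the first k points *)

Section Embedding.

Variables (k n : nat) (lekn : (k <= n)%N).
Local Notation w := (widen_ord lekn).
Local Notation embed := (@embed_perm k n lekn).

Lemma widen_case (x : 'I_n) : (exists a : 'I_k, x = w a) \/ (k <= x)%N.
Proof.
case: (ltnP x k) => [ltxk|]; [left | by right].
by exists (Ordinal ltxk); apply/val_inj.
Qed.

Lemma embed_perm_widen (s : 'S_k) (a : 'I_k) : embed s (w a) = w (s a).
Proof.
rewrite permE /embed_fun insubT //= => lt_a.
by congr (w (s _)); apply: val_inj.
Qed.

Lemma embed_perm_ge (s : 'S_k) (x : 'I_n) : (k <= x)%N -> embed s x = x.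
Proof. by move=> lekx; rewrite permE /embed_fun insubF // ltnNge lekx. Qed.

Lemma embed_permM (s t : 'S_k) : embed (s * t)%g = (embed s * embed t)%g.
Proof.
apply/permP => x; rewrite permM; case: (widen_case x) => [[a ->]|lekx].
  by rewrite !embed_perm_widen permM.
by rewrite !embed_perm_ge.
Qed.

Lemma widen_inj : injective w.
Proof. by move=> a b /(congr1 val) /= /val_inj. Qed.

Lemma embed_perm_inj : injective embed.
Proof.
move=> s t eq_st; apply/permP => a; apply: widen_inj.
by rewrite -!embed_perm_widen eq_st.
Qed.

Lemma embed_tperm (a b : 'I_k) : embed (tperm a b) = tperm (w a) (w b).
Proof.
apply/permP => x; case: (widen_case x) => [[c ->]|lekx].
  rewrite embed_perm_widen; case: (tpermP a b c) => [->|->|ca cb].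
  - by rewrite tpermL.
  - by rewrite tpermR.
  by rewrite tpermD // (inj_eq widen_inj) eq_sym; apply/eqP.
rewrite embed_perm_ge // tpermD // -val_eqE neq_ltn /=.
  by rewrite (leq_trans (ltn_ord a)).
by rewrite (leq_trans (ltn_ord b)).
Qed.

Lemma odd_embed_perm (s : 'S_k) : odd_perm (embed s) = odd_perm s.
Proof.
have embed1 : embed 1 = 1%g.
  apply/permP => x; case: (widen_case x) => [[c ->]|lekx].
    by rewrite embed_perm_widen !perm1.
  by rewrite embed_perm_ge // perm1.
have [ts -> _] := prod_tpermP s.
elim: ts => [|[a b] ts IH]; first by rewrite big_nil embed1 !odd_perm1.
rewrite big_cons embed_permM embed_tperm !odd_permM IH !odd_tperm.
by rewrite (inj_eq widen_inj).
Qed.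

(** [embed_perm] is onto the permutations fixing the points from k on. *)
Lemma embed_perm_ex (t : 'S_n) :
  (forall x : 'I_n, (k <= x)%N -> t x = x) -> exists s, t = embed s.
Proof.
move=> fix_t.
have exP a : exists b, t (w a) = w b.
  case: (widen_case (t (w a))) => // lek; have := fix_t _ lek.
  by move/perm_inj=> eq_t; move: lek; rewrite eq_t /= leqNgt ltn_ord.
have [f fP] := fin_all_exists exP.
have inj_f : injective f.
  move=> a b eq_f; apply/widen_inj/(@perm_inj _ t).
  by rewrite !fP eq_f.
exists (perm inj_f); apply/permP => x; case: (widen_case x) => [[c ->]|lekx].
  by rewrite embed_perm_widen permE fP.
by rewrite embed_perm_ge // fix_t.
Qed.

End Embedding.

Section Injections.

Variables (k n : nat) (lekn : (k <= n)%N).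
Local Notation w := (widen_ord lekn).

Lemma injection_extends (f : 'I_k -> 'I_n) :
  injective f -> exists y : 'S_n, forall a, y (w a) = f a.
Proof.
(* List the values of f, then all the other points. *)
move=> inj_f; pose s := codom f ++ [seq x <- enum 'I_n | x \notin codom f].
have uniq_s : uniq s.
  rewrite cat_uniq filter_uniq ?enum_uniq // andbT.
  rewrite (introT (injectiveP _) inj_f : uniq (codom f)) /=.
  by apply/hasPn => x; rewrite mem_filter => /andP[].
have size_s : size s = n.
  rewrite -[RHS](card_ord n) cardE; apply: perm_size.
  apply: uniq_perm (uniq_s) (enum_uniq _) _ => x.
  by rewrite mem_cat mem_filter mem_enum andbT orbN.
have nth_s (i j : 'I_n) : nth i s j = nth j s j.
  by apply: set_nth_default; rewrite size_s.
have inj_y : injective (fun i : 'I_n => nth i s i).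
  move=> i j eq_ij; apply/val_inj/eqP => /=.
  by rewrite -(nth_uniq i _ _ uniq_s) ?size_s // (nth_s i j); apply/eqP.
exists (perm inj_y) => a; rewrite permE /= nth_cat size_codom card_ord ltn_ord.
rewrite (set_nth_default (f a)) ?size_codom ?card_ord //=.
by rewrite codomE (nth_map a) ?size_enum_ord // nth_ord_enum.
Qed.

(** Right multiplication by an extension of f carries the permutations that fix
the first k points to those extending f, so all the fibres of the restriction
have the same cardinal K, which is n`! / n ^_ k. *)
Lemma sum_over_injections (F : {ffun 'I_k -> 'I_n} -> algC) :
  (n ^_ k)%:R * (\sum_(y : 'S_n) F [ffun a => y (w a)]) =
  n`!%:R * \sum_(f : {ffun 'I_k -> 'I_n} | injectiveb f) F f.
Proof.
pose restr (y : 'S_n) := [ffun a => y (w a)].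
pose K := #|[pred y | restr y == finfun w]|.
have restr_inj y : injectiveb (restr y).
  by apply/injectiveP => a b; rewrite !ffunE => /perm_inj/widen_inj.
have fibre (f : {ffun 'I_k -> 'I_n}) :
    injectiveb f -> #|[pred y | restr y == f]| = K.
  move/injectiveP/injection_extends=> [y0 y0P].
  rewrite /K -!sum1_card (reindex_inj (mulIg y0)) /=.
  apply: eq_bigl => y; rewrite !inE; apply/eqP/eqP => /ffunP eq_y.
    apply/ffunP => a; have := eq_y a; rewrite !ffunE permM -y0P.
    exact: perm_inj.
  by apply/ffunP => a; have := eq_y a; rewrite !ffunE permM -y0P => ->.
have group (G : {ffun 'I_k -> 'I_n} -> algC) :
    \sum_(y : 'S_n) G (restr y) =
    K%:R * \sum_(f : {ffun 'I_k -> 'I_n} | injectiveb f) G f.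
  rewrite (partition_big restr (fun f => injectiveb f)) //= mulr_sumr.
  apply: eq_bigr => f inj_f; rewrite -(fibre f inj_f) -sum1_card natr_sum.
  by rewrite mulr_suml; apply: eq_bigr => y /eqP ->; rewrite mul1r.
have -> : n`!%:R = K%:R * (n ^_ k)%:R :> algC.
  have <- : \sum_(y : 'S_n) 1 = n`!%:R :> algC.
    rewrite -(card_Sn n) -sum1_card natr_sum.
    by apply: eq_bigl => y; rewrite inE.
  rewrite (group (fun=> 1)); congr (_ * _).
  have -> : (n ^_ k = #|[set f : {ffun 'I_k -> 'I_n} | injectiveb f]|)%N.
    by rewrite card_inj_ffuns !card_ord.
  rewrite -sum1_card natr_sum.
  by apply: eq_bigl => f; rewrite inE.
by rewrite group mulrA [K%:R * _]mulrC.
Qed.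

End Injections.

(** * Functions constant on the cycles of a permutation *)

Section InvariantFunctions.

Variables (k : nat) (v : 'S_k) (T : finType).

Lemma cycle_at_perm (a : 'I_k) : cycle_at v (v a) = cycle_at v a.
Proof.
by apply/val_inj; rewrite /= (porbit_perm v 1).
Qed.

Lemma mem_cycle_at (a : 'I_k) (b : cycle_of v) :
  (a \in val b) = (cycle_at v a == b).
Proof.
case: b => b /= b_v; have /imsetP[x _ eq_b] := b_v.
by rewrite -val_eqE /= eq_b eq_porbit_mem porbit_sym.
Qed.

Lemma sum_invariant (F : {ffun 'I_k -> T} -> algC) :
  \sum_(h : {ffun 'I_k -> T} | [forall a, h (v a) == h a]) F h =
  \sum_(phi : {ffun cycle_of v -> T}) F [ffun a => phi (cycle_at v a)].
Proof.
have rep (b : cycle_of v) : exists a, cycle_at v a = b.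
  case: b => b b_v; have /imsetP[x _ eq_b] := b_v.
  by exists x; apply/val_inj.
have [r rP] := fin_all_exists rep.
pose spread (phi : {ffun cycle_of v -> T}) := [ffun a => phi (cycle_at v a)].
rewrite (reindex spread) /=; last first.
  exists (fun h : {ffun 'I_k -> T} => [ffun b => h (r b)]) => [phi _|h].
    by apply/ffunP => b; rewrite !ffunE rP.
  rewrite inE => /forallP hv; apply/ffunP => a; rewrite !ffunE.
  have : r (cycle_at v a) \in porbit v a.
    by rewrite -[porbit v a]/(val (cycle_at v a)) mem_cycle_at rP.
  case/porbitP => i ->; rewrite permX.
  by elim: i => //= i IH; rewrite (eqP (hv _)).
apply: eq_bigl => phi; apply/forallP => a.
by rewrite !ffunE cycle_at_perm.
Qed.

(** Cycle by cycle, the values can be chosen independently of each other. *)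
Lemma sum_invariant_prod (P : 'I_k -> pred T) :
  \sum_(h : {ffun 'I_k -> T} | [forall a, h (v a) == h a])
     [forall a, P a (h a)]%:R =
  \prod_(b in porbits v) #|[set x | [forall (a | a \in b), P a x]]|%:R :> algC.
Proof.
rewrite sum_invariant [RHS]big_sub.
under [RHS]eq_bigr => b _ do
  rewrite -sum1dep_card natr_sum big_mkcond /=.
rewrite bigA_distr_bigA /=; apply: eq_bigr => phi _.
have [/forallP allP|] :=
  boolP [forall a, P a ([ffun a' => phi (cycle_at v a')] a)].
  rewrite big1 // => b _; rewrite ifT //; apply/forall_inP => a.
  by rewrite mem_cycle_at => /eqP <-; have := allP a; rewrite ffunE.
rewrite negb_forall => /existsP[a nPa]; rewrite (bigD1 (cycle_at v a)) //=.
rewrite ifN ?mul0r //; apply: contra nPa => /forall_inP allP.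
by rewrite ffunE; apply: allP; apply: porbit_id.
Qed.

End InvariantFunctions.

(** * The Young symmetrizer *)

Section YoungSymmetrizer.

Variables (n : nat) (la : seq nat).
Hypothesis sumla : sumn la = n.

Local Notation row_of a := (reshape_index la (val a)).
Local Notation col_of a := (reshape_offset la (val a)).
Local Notation R := (row_stab n la).
Local Notation C := (col_stab n la).
Local Notation N := (gcard [set: 'S_n]%G).
Local Notation ix := (@gring_index _ [set: 'S_n]%G).
Local Notation aG := (regular_repr algC [set: 'S_n]%G).

Lemma cell_inj (a b : 'I_n) :
  row_of a = row_of b -> col_of a = col_of b -> a = b.
Proof.
move=> rab cab; apply/val_inj.
by rewrite -[LHS](reshape_indexK la) -[RHS](reshape_indexK la) rab cab.
Qed.

Lemma row_lt (a : 'I_n) : (row_of a < size la)%N.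
Proof. by apply: reshape_indexP; rewrite sumla; exact: ltn_ord. Qed.

Lemma col_lt (a : 'I_n) : (col_of a < nth 0 la (row_of a))%N.
Proof. by apply: reshape_offsetP; rewrite sumla; exact: ltn_ord. Qed.

Lemma cell_ex (r j : nat) :
  (j < nth 0 la r)%N -> exists a : 'I_n, row_of a = r /\ col_of a = j.
Proof.
move=> ltj; have lt := flatten_indexP ltj; rewrite sumla in lt.
by exists (Ordinal lt); rewrite /= flatten_indexKl // flatten_indexKr.
Qed.

Lemma row_stabP (s : 'S_n) :
  reflect (forall a, row_of (s a) = row_of a) (s \in R).
Proof. by rewrite inE; apply: (iffP forallP) => H a; apply/eqP; exact: H. Qed.

Lemma col_stabP (t : 'S_n) :
  reflect (forall a, col_of (t a) = col_of a) (t \in C).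
Proof. by rewrite inE; apply: (iffP forallP) => H a; apply/eqP; exact: H. Qed.

Lemma row_stabM (s u : 'S_n) : s \in R -> (s * u \in R)%g = (u \in R).
Proof.
move/row_stabP=> sR; apply/row_stabP/row_stabP => H a; last first.
  by rewrite permM H sR.
by have := H (s^-1%g a); rewrite permM permKV => ->; rewrite -sR permKV.
Qed.

Lemma col_stabM (t u : 'S_n) : t \in C -> (u * t \in C)%g = (u \in C).
Proof.
move/col_stabP=> tC.
by apply/col_stabP/col_stabP => uC a; have := uC a; rewrite permM tC.
Qed.

Lemma tperm_row_stab (x y : 'I_n) : row_of x = row_of y -> tperm x y \in R.
Proof. by move=> rxy; apply/row_stabP => a; case: tpermP => // ->. Qed.

Lemma tperm_col_stab (x y : 'I_n) : col_of x = col_of y -> tperm x y \in C.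
Proof. by move=> cxy; apply/col_stabP => a; case: tpermP => // ->. Qed.

(** The dominance argument, by counting. The permutation h moves every cell
to a column, no two cells of a row going to the same one. Given l, a row of
length r thus sends at most min(r, l) cells to the first l columns, which is
the number of its own cells lying there; as h is a bijection, the totals agree,
so every row attains its bound. With l = r this says that a row of length r
sends all its cells to the first r columns. *)
Lemma short_rows (h : 'S_n) :
  (forall x y, row_of x = row_of y -> col_of (h x) = col_of (h y) -> x = y) ->
  forall z, (col_of (h z) < nth 0 la (row_of z))%N.
Proof.
move=> inj_h z0; rewrite ltnNge; apply/negP => le_z0.
set l := nth 0%N la (row_of z0) in le_z0.
have in_row r : (#|[set z : 'I_n | (row_of z == r) && (col_of (h z) < l)%N]|
                <= #|[set z : 'I_n | (row_of z == r) && (col_of z < l)%N]|)%N.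
  have [le_r | lt_r] := leqP (nth 0 la r) l.
    apply/subset_leq_card/subsetP => z; rewrite !inE => /andP[/eqP rz _].
    by rewrite rz eqxx /= (leq_trans _ le_r) // -rz col_lt.
  pose P (z u : 'I_n) :=
    row_of z = r -> (col_of (h z) < l)%N ->
    row_of u = r /\ col_of u = col_of (h z).
  have exP z : exists u, P z u.
    have [ltz|ge_z] := boolP (col_of (h z) < l)%N; last first.
      by exists z => _ ltz; rewrite ltz in ge_z.
    by case: (cell_ex (ltn_trans ltz lt_r)) => u [ru cu]; exists u => _ _.
  have [f fP] := fin_all_exists exP.
  rewrite -(@card_in_imset _ _ f).
    apply/subset_leq_card/subsetP => _ /imsetP[z + ->].
    rewrite !inE => /andP[/eqP rz cz]; have [-> ->] := fP z rz cz.
    by rewrite eqxx.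
  move=> x y; rewrite !inE => /andP[/eqP rx cx] /andP[/eqP ry cy] eq_f.
  apply: inj_h; first by rewrite rx.
  by have [_ <-] := fP x rx cx; have [_ <-] := fP y ry cy; rewrite eq_f.
(* z0 makes the inequality strict in its row, of length l. *)
have lt_row :
    (#|[set z : 'I_n | (row_of z == row_of z0) && (col_of (h z) < l)%N]|
     < #|[set z : 'I_n | (row_of z == row_of z0) && (col_of z < l)%N]|)%N.
  apply/proper_card/properP; split.
    apply/subsetP=> z; rewrite !inE => /andP[/eqP rz _].
    by rewrite rz eqxx /= /l -rz col_lt.
  by exists z0; rewrite !inE eqxx /= ?col_lt // -leqNgt.
have by_rows (A : pred 'I_n) :
    #|A| = (\sum_(r < size la) #|[set z : 'I_n | (row_of z == r) && A z]|)%N.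
  rewrite -sum1_card (partition_big (fun z => Ordinal (row_lt z)) predT) //=.
  apply: eq_bigr => r _; rewrite sum1_card; apply: eq_card => z.
  by rewrite !inE andbC; congr (_ && _).
have: (#|[pred z : 'I_n | (col_of (h z) < l)%N]|
       < #|[pred z : 'I_n | (col_of z < l)%N]|)%N.
  rewrite !by_rows /= (bigD1 (Ordinal (row_lt z0))) //=.
  rewrite [X in (_ < X)%N](bigD1 (Ordinal (row_lt z0))) //= -addSn.
  by apply: leq_add => //; apply: leq_sum => r _.
suff -> : #|[pred z : 'I_n | (col_of (h z) < l)%N]| =
          #|[pred z : 'I_n | (col_of z < l)%N]| by rewrite ltnn.
rewrite -[RHS]cardsE -(card_preimset _ (@perm_inj _ h)).
by apply: eq_card => z; rewrite !inE.
Qed.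

(** By [short_rows] there is a cell in the row of z and in the column of
g^-1 z; moving each z there is an element of R, which composed with g gives an
element of C. *)
Lemma col_row_factor (g : 'S_n) :
  (forall x y, col_of x = col_of y -> row_of (g x) = row_of (g y) -> x = y) ->
  exists t s, [/\ t \in C, s \in R & g = (t * s)%g].
Proof.
move=> inj_g.
have lt_col : forall z, (col_of (g^-1%g z) < nth 0 la (row_of z))%N.
  apply: short_rows => x y rxy cxy; apply: (@perm_inj _ g^-1%g).
  by apply: inj_g => //; rewrite !permKV.
have [u uP] := fin_all_exists (fun z => cell_ex (lt_col z)).
have inj_u : injective u.
  move=> x y eq_u; have [rx cx] := uP x; have [ry cy] := uP y.
  apply: (@perm_inj _ g^-1%g); apply: inj_g; first by rewrite -cx -cy eq_u.
  by rewrite !permKV -rx -ry eq_u.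
exists (g * perm inj_u)%g, (perm inj_u)^-1%g; split; last by rewrite mulgK.
  by apply/col_stabP => a; rewrite permM permE (uP _).2 permK.
by apply/row_stabP => a; rewrite -{2}[a](permKV (perm inj_u)) permE (uP _).1.
Qed.

Definition basis_vec (x : 'S_n) : 'rV[algC]_N := delta_mx 0 (ix x).

(** The product of the signed column sum, of g and of the row sum. *)
Definition sandwich (g : 'S_n) : 'rV[algC]_N :=
  \sum_(s in R) \sum_(t in C) (-1) ^+ t *: basis_vec (t * g * s)%g.

Lemma sandwichMr (g s : 'S_n) : s \in R -> sandwich (g * s)%g = sandwich g.
Proof.
move=> sR; rewrite /sandwich [RHS](reindex_inj (mulgI s)) /=.
apply: eq_big => [u|u _]; first by rewrite row_stabM.
by apply: eq_bigr => t _; rewrite !mulgA.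
Qed.

Lemma sandwichMl (g t : 'S_n) :
  t \in C -> sandwich (t * g)%g = (-1) ^+ t *: sandwich g.
Proof.
move=> tC; rewrite /sandwich scaler_sumr; apply: eq_bigr => s _.
rewrite scaler_sumr [RHS](reindex_inj (mulIg t)) /=.
apply: eq_big => [u|u _]; first by rewrite col_stabM.
by rewrite scalerA -signr_addb odd_permM addbC addbK !mulgA.
Qed.

Lemma sandwich1 : sandwich 1 = young_symmetrizer n la.
Proof. by do 2![apply: eq_bigr => ? _]; rewrite mulg1. Qed.

(** Von Neumann's lemma. If g sends two cells x, y of the same column to the
same row, then the transposition (x y) can be absorbed on one side with a sign
and on the other side without, so that the product vanishes; otherwise g
is in C * R and is itself absorbed. *)
Lemma sandwich_collinear (g : 'S_n) :
  exists a : algC, sandwich g = a *: young_symmetrizer n la.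
Proof.
have [/existsP[x /existsP[y /and3P[neq_xy /eqP cxy /eqP rxy]]]|no_pair] :=
  boolP [exists x, exists y,
    [&& x != y, col_of x == col_of y & row_of (g x) == row_of (g y)]].
  exists 0; rewrite scale0r.
  have tC := tperm_col_stab cxy; have tR := tperm_row_stab rxy.
  have := sandwichMl g tC; rewrite odd_tperm neq_xy expr1 scaleN1r.
  have -> : (tperm x y * g = g * tperm (g x) (g y))%g.
    by rewrite -tpermJ -conjgC.
  rewrite sandwichMr // => /eqP; rewrite -addr_eq0 -mulr2n -scaler_nat.
  by rewrite scaler_eq0 pnatr_eq0 => /eqP.
have [|t [s [tC sR ->]]] := @col_row_factor g.
  move=> x y cxy rxy; apply/eqP; apply/idPn => neq_xy; case/negP: no_pair.
  apply/existsP; exists x; apply/existsP; exists y.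
  by rewrite neq_xy cxy rxy !eqxx.
exists ((-1) ^+ t); rewrite sandwichMr // -(mulg1 t) sandwichMl // sandwich1.
by rewrite mulg1.
Qed.

Local Notation c := (young_symmetrizer n la).

(** Multiplication by the Young symmetrizer, x |-> c * x. *)
Definition young_mulmx : 'M[algC]_N :=
  \matrix_i (c *m aG (enum_val i)).

Lemma basis_vecM (x y : 'S_n) : basis_vec x *m aG y = basis_vec (x * y)%g.
Proof. by rewrite -rowE rowK gring_indexK. Qed.

Lemma basis_vec_young (x : 'S_n) : basis_vec x *m young_mulmx = c *m aG x.
Proof. by rewrite -rowE rowK gring_indexK. Qed.

Lemma specht_mxE : (specht_mx n la :=: young_mulmx)%MS.
Proof.
suff -> : young_mulmx = enveloping_algebra_mx aG *m lin_mul_row c.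
  exact: genmxE.
by apply/row_matrixP => i; rewrite row_mul !rowK mul_rV_lin1 /= mxvecK.
Qed.

(** The square of c is a sum of sandwiches, one for each product s * t. *)
Lemma young_sqr : exists a : algC, c *m young_mulmx = a *: c.
Proof.
have [f fP] : exists f : 'S_n -> algC, forall g, sandwich g = f g *: c.
  exact: fin_all_exists sandwich_collinear.
exists (\sum_(s in R) \sum_(t in C) (-1) ^+ t * f (s * t)%g).
rewrite scaler_suml {1}/young_symmetrizer mulmx_suml.
under eq_bigr do rewrite mulmx_suml.
transitivity (\sum_(u in R) \sum_(t in C) \sum_(s in R) \sum_(v in C)
   ((-1) ^+ t * (-1) ^+ v) *: basis_vec (v * (s * t) * u)%g).
  apply: eq_bigr => u _; apply: eq_bigr => t _.
  rewrite -scalemxAl basis_vec_young mulmx_suml scaler_sumr.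
  apply: eq_bigr => s _; rewrite mulmx_suml scaler_sumr.
  apply: eq_bigr => v _; rewrite -scalemxAl basis_vecM scalerA.
  by rewrite !mulgA.
under [RHS]eq_bigr do rewrite scaler_suml.
rewrite exchange_big [RHS]exchange_big /=; apply: eq_bigr => t _.
rewrite exchange_big /=; apply: eq_bigr => s _.
rewrite -scalerA -fP scaler_sumr; apply: eq_bigr => u _.
by rewrite scaler_sumr; apply: eq_bigr => v _; rewrite scalerA.
Qed.

Lemma young_mulmx_sqr :
  exists a : algC, young_mulmx *m young_mulmx = a *: young_mulmx.
Proof.
have [a ca] := young_sqr; exists a; apply/row_matrixP => i.
have comm x : aG x *m young_mulmx = young_mulmx *m aG x.
  apply/row_matrixP => j; rewrite !row_mul !rowK basis_vec_young.
  by rewrite repr_mxM ?inE // mulmxA.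
by rewrite row_mul linearZ /= !rowK -mulmxA comm mulmxA ca -scalemxAl.
Qed.

(** The sum over y of the coefficients of c at the conjugates g ^ y. *)
Definition young_trace (g : 'S_n) : algC :=
  \sum_(y : 'S_n) \sum_(s in R) \sum_(t in C) (-1) ^+ t * (t * s == g ^ y)%g%:R.

Lemma mxtrace_young (g : 'S_n) : \tr (young_mulmx *m aG g) = young_trace g^-1.
Proof.
rewrite /mxtrace (reindex ix) /=; last first.
  exists enum_val => x _; last exact: gring_valK.
  by apply: gring_indexK; rewrite inE.
rewrite /young_trace [RHS](reindex_inj invg_inj) /=.
apply: eq_bigr => y _.
have -> (M : 'M[algC]_N) : M (ix y) (ix y) = (row (ix y) M) 0 (ix y).
  by rewrite mxE.
rewrite row_mul rowK gring_indexK ?inE // -mulmxA -repr_mxM ?inE //.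
rewrite mulmx_suml summxE; apply: eq_bigr => s _.
rewrite mulmx_suml summxE; apply: eq_bigr => t _.
rewrite -scalemxAl basis_vecM !mxE eqxx /=.
rewrite (can_in_eq (@gring_indexK _ _)) ?inE //.
congr (_ * (nat_of_bool _)%:R).
rewrite -[RHS](inj_eq (mulIg (y * g)%g)) eq_sym; congr (_ == _).
by rewrite conjgE invgK !mulgA !mulgKV.
Qed.

(** Only the identity preserves both rows and columns, so each y contributes
the term s = t = 1. *)
Lemma young_trace1 : young_trace 1 = (n`!)%:R.
Proof.
have idR : 1%g \in R by apply/row_stabP => a; rewrite perm1.
have idC : 1%g \in C by apply/col_stabP => a; rewrite perm1.
rewrite /young_trace -[in RHS](card_Sn n) -sumr_const.
apply: eq_big => [y|y _]; first by rewrite inE.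
rewrite conj1g (bigD1 1%g) //= (bigD1 1%g) //= odd_perm1 mulg1 eqxx mulr1.
have ts1 (s t : 'S_n) : s \in R -> t \in C -> (t * s)%g == 1%g -> s = 1%g.
  move=> /row_stabP sR /col_stabP tC; rewrite -eq_invg_mul => /eqP tV.
  apply/permP => a; rewrite perm1; apply: cell_inj; first exact: sR.
  by rewrite -tC -permM -tV mulVg perm1.
rewrite !big1 ?addr0 //; last first.
  by move=> t /andP[_ /negPf]; rewrite mulg1 => ->; rewrite mulr0.
move=> s /andP[sR ne_s]; rewrite big1 // => t tC.
case: eqP => [/eqP/(ts1 _ _ sR tC) eq_s1|_]; last by rewrite mulr0.
by rewrite eq_s1 eqxx in ne_s.
Qed.

Lemma young_trace_real (g : 'S_n) : (young_trace g)^* = young_trace g.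
Proof.
rewrite /young_trace rmorph_sum; apply: eq_bigr => y _.
rewrite rmorph_sum; apply: eq_bigr => s _; rewrite rmorph_sum.
by apply: eq_bigr => t _; rewrite rmorphM /= rmorph_sign rmorph_nat.
Qed.

(** The trace computation gives the character at g as a multiple of
[young_trace] at g^-1. The inverse disappears because a character takes
conjugate values at g and g^-1 while [young_trace] is real. *)
Lemma specht_char_ratio (g : 'S_n) :
  specht_char n la g / specht_char n la 1%g = young_trace g / (n`!)%:R.
Proof.
have [a aL] := young_mulmx_sqr.
have trG x : young_trace x^-1 = a * specht_char n la x.
  rewrite -mxtrace_young.
  rewrite (mxtrace_submod (specht_mx_module n la) specht_mxE aL) ?inE //.
  by rewrite cfunE inE.
have fact_neq0 : n`!%:R != 0 :> algC by rewrite pnatr_eq0 -lt0n fact_gt0.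
have tr1 := trG 1%g; rewrite invg1 young_trace1 in tr1.
have [a0 chi0] : a != 0 /\ specht_char n la 1%g != 0.
  by apply/andP; rewrite -negb_or -mulf_eq0 -tr1.
have conj_a : a^* = a.
  rewrite -[a](mulfK chi0) -tr1 fmorph_div rmorph_nat /=.
  by rewrite -char_inv ?invg1 // cfRepr_char.
rewrite -[g in LHS]invgK char_inv ?cfRepr_char //.
rewrite -[specht_char n la g^-1%g](mulKf a0) -trG invgK.
rewrite rmorphM fmorphV /= conj_a.
by rewrite young_trace_real tr1 invfM mulrA [a^-1 * _]mulrC.
Qed.

Lemma row_stabV (s : 'S_n) : (s^-1 \in R)%g = (s \in R).
Proof.
by apply/row_stabP/row_stabP => sR a; rewrite -[in LHS]sR ?permK ?permKV.
Qed.

(** The coefficient of the Young symmetrizer at h: a factorization t * s = h is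
recorded by u = s^-1. *)
Definition young_coef (h : 'S_n) : algC :=
  \sum_(u in R | (h * u \in C)%g) (-1) ^+ (h * u)%g.

Lemma young_traceE (g : 'S_n) :
  young_trace g = \sum_(y : 'S_n) young_coef (g ^ y)%g.
Proof.
apply: eq_bigr => y _; set h := (g ^ y)%g.
rewrite /young_coef big_mkcondr (reindex_inj invg_inj) /=.
apply: eq_big => [s|s _]; first by rewrite row_stabV.
have coefE t : (t * s^-1 == h)%g = (t == h * s)%g.
  by rewrite -(inj_eq (mulIg s)) mulgKV.
case: ifPn => [hsC|hsNC]; last first.
  apply: big1 => t tC; rewrite coefE.
  by case: eqP => [eq_t|_]; [rewrite -eq_t tC in hsNC | rewrite mulr0].
rewrite (bigD1 _ hsC) /= coefE eqxx mulr1 big1 ?addr0 // => t /andP[_ ne_t].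
by rewrite coefE (negPf ne_t) mulr0.
Qed.

(** * From factorizations in S(n) to factorizations in S(k) *)

Section Restriction.

Variables (k : nat) (lekn : (k <= n)%N) (mu : 'S_k).

(** Here f places the k points in the diagram; u has to preserve the rows of f,
and the other factor mu * u its columns. *)
Definition filling_sum (f : 'I_k -> 'I_n) : algC :=
  \sum_(u : 'S_k | [forall a, row_of (f (u a)) == row_of (f a)] &&
      [forall a, col_of (f ((mu * u)%g a)) == col_of (f a)]) (-1) ^+ (mu * u)%g.

Lemma young_coef_embed (y : 'S_n) :
  young_coef (embed_perm lekn mu ^ y)%g =
  filling_sum (fun a => y (widen_ord lekn a)).
Proof.
have stabJ (F : 'I_n -> nat) (v : 'S_n) :
    (forall a, F ((v ^ y)%g a) = F a) <-> (forall a, F (y (v a)) = F (y a)).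
  by split=> vP a; [rewrite -permJ vP | rewrite -[a](permKV y) permJ vP].
(* The embedding of mu does not move x, so v x = (mu * v) x; hence the cell
   y (v x) is in the row of y x because of v, in its column because of mu * v. *)
have fixed (v : 'S_n) : (v ^ y)%g \in R ->
    ((embed_perm lekn mu * v) ^ y)%g \in C ->
    forall x : 'I_n, (k <= x)%N -> v x = x.
  move=> /row_stabP vR /col_stabP vC x lekx.
  have rv := (stabJ (fun a => row_of a) v).1 vR x.
  have cv := (stabJ (fun a => col_of a) _).1 vC x.
  rewrite permM embed_perm_ge // in cv.
  by apply/(@perm_inj _ y)/cell_inj.
rewrite /young_coef (reindex_inj (conjg_inj y)) /=.
pose restrict v : 'S_k := odflt 1%g [pick s | embed_perm lekn s == v].
rewrite (reindex (embed_perm lekn)) /=; last first.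
  exists restrict => [s _|v].
    rewrite /restrict; case: pickP => [s' /eqP/embed_perm_inj //|/(_ s)].
    by rewrite eqxx.
  rewrite inE -conjMg => /andP[vR vC].
  have [s ->] := embed_perm_ex lekn (fixed v vR vC).
  rewrite /restrict; case: pickP => [s' /eqP //|/(_ s)].
  by rewrite eqxx.
have stabE (F : 'I_n -> nat) (v : 'S_k) :
    (forall a, F ((embed_perm lekn v ^ y)%g a) = F a) <->
    (forall a, F (y (widen_ord lekn (v a))) = F (y (widen_ord lekn a))).
  split=> [/stabJ vP a|vP]; first by rewrite -embed_perm_widen vP.
  apply/stabJ => x; case: (widen_case lekn x) => [[a ->]|lekx].
    by rewrite embed_perm_widen.
  by rewrite embed_perm_ge.
apply: eq_big => [u|u _].
  rewrite -conjMg -embed_permM; congr (_ && _).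
    by apply/row_stabP/forallP => [/(stabE (fun a => row_of a)) uP a|uP];
      [apply/eqP | apply/(stabE (fun a => row_of a)) => a; apply/eqP].
  by apply/col_stabP/forallP => [/(stabE (fun a => col_of a)) uP a|uP];
    [apply/eqP | apply/(stabE (fun a => col_of a)) => a; apply/eqP].
by rewrite -conjMg -embed_permM odd_permJ odd_embed_perm.
Qed.

End Restriction.

End YoungSymmetrizer.

Section Fillings.

Variables (n : nat) (la : seq nat).
Hypothesis sumla : sumn la = n.

(** If f x = f y, multiplication of u by the transposition (x y) leaves both
conditions unchanged and reverses the sign. *)
Lemma filling_sum_eq0 (k : nat) (mu : 'S_k) (f : 'I_k -> 'I_n) :
  ~~ injectiveb f -> filling_sum la mu f = 0.
Proof.
move=> /injectivePn[x [y neq_xy fxy]].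
have f_tperm a : f (tperm x y a) = f a by case: tpermP => // ->.
suff : filling_sum la mu f = - filling_sum la mu f.
  move/eqP; rewrite -addr_eq0 -mulr2n -mulr_natr mulf_eq0 pnatr_eq0 orbF.
  by move/eqP.
rewrite {1}/filling_sum (reindex_inj (mulIg (tperm x y))) -sumrN.
apply: eq_big => [u|u _].
  by congr (_ && _); apply: eq_forallb => a; rewrite !permM f_tperm.
by rewrite mulgA (odd_permM _ (tperm x y)) odd_tperm neq_xy addbT signrN.
Qed.

Lemma eq_filling_sum (k : nat) (mu : 'S_k) (f g : 'I_k -> 'I_n) :
  f =1 g -> filling_sum la mu f = filling_sum la mu g.
Proof.
move=> fg; apply: eq_bigl => u.
by congr (_ && _); apply: eq_forallb => a; rewrite !fg.
Qed.

Lemma normalised_char_fillings (k : nat) (lekn : (k <= n)%N) (mu : 'S_k) :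
  normalised_char lekn la mu =
  \sum_(f : {ffun 'I_k -> 'I_n}) filling_sum la mu f.
Proof.
rewrite /normalised_char -mulrA specht_char_ratio // young_traceE mulrA.
under eq_bigr do rewrite young_coef_embed //.
under eq_bigr => y _ do
  rewrite -(@eq_filling_sum _ mu _ _ (ffunE (fun a => y (widen_ord lekn a)))).
rewrite (sum_over_injections lekn (fun f => filling_sum la mu f)) mulrAC.
rewrite mulfV ?mul1r ?pnatr_eq0 -?lt0n ?fact_gt0 //.
rewrite [RHS](bigID (fun f : {ffun 'I_k -> 'I_n} => injectiveb f)) /=.
by rewrite [X in _ + X]big1 ?addr0 // => f; apply: filling_sum_eq0.
Qed.

Lemma sum1r_card (I : finType) (P : pred I) :
  \sum_(i | P i) 1 = #|[set i | P i]|%:R :> algC.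
Proof. by rewrite -sum1dep_card natr_sum. Qed.

(** A filling is the pair of its rows g and of its columns h, subject to the
condition that every cell lies in the diagram. *)
Lemma count_fillings (k L : nat) (size_la : size la = L) (u v : 'S_k) :
 \sum_(f : {ffun 'I_k -> 'I_n} |
    [forall a, reshape_index la (f (u a)) == reshape_index la (f a)] &&
    [forall a, reshape_offset la (f (v a)) == reshape_offset la (f a)])
   (1 : algC) =
 \sum_(g : {ffun 'I_k -> 'I_L} | [forall a, g (u a) == g a])
 \sum_(h : {ffun 'I_k -> 'I_n} | [forall a, h (v a) == h a])
    [forall a, h a < nth 0 la (g a)]%N%:R.
Proof.
have lt_col (x : 'I_n) : (reshape_offset la x < n)%N.
  exact: leq_ltn_trans (leq_subr _ _) (ltn_ord x).
have lt_row (x : 'I_n) : (reshape_index la x < L)%N.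
  by rewrite -size_la; apply: row_lt.
pose rw (f : {ffun 'I_k -> 'I_n}) := [ffun a => Ordinal (lt_row (f a))].
pose cl (f : {ffun 'I_k -> 'I_n}) := [ffun a => Ordinal (lt_col (f a))].
rewrite (partition_big rw (fun g => [forall a, g (u a) == g a])) /=; last first.
  move=> f /andP[/forallP fu _]; apply/forallP => a; rewrite !ffunE.
  by rewrite -val_eqE /= fu.
apply: eq_bigr => g /forallP gu.
pose row_len := fun a => nth 0%N la (g a).
rewrite [RHS](eq_bigr (fun h : {ffun 'I_k -> 'I_n} =>
  if [forall a, h a < row_len a]%N then 1 else 0)); last first.
  by move=> h _; case: ifP.
rewrite -big_mkcondr /= !sum1r_card.
congr _%:R; rewrite -(@card_in_imset _ _ cl); last first.
  move=> f1 f2; rewrite !inE => /andP[_ /eqP g1] /andP[_ /eqP g2] eq_cl.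
  apply/ffunP => a; apply: (cell_inj (la := la)).
    have eq_rw : rw f1 = rw f2 by rewrite g1.
    have /(congr1 (fun h : {ffun 'I_k -> 'I_L} => val (h a))) := eq_rw.
    by rewrite !ffunE.
  have /(congr1 (fun h : {ffun 'I_k -> 'I_n} => val (h a))) := eq_cl.
  by rewrite !ffunE.
apply: eq_card => h; rewrite !inE.
apply/imsetP/andP => [[f]|[/forallP hv /forallP lt_h]].
  rewrite !inE => /andP[/andP[_ /forallP fv] /eqP rwf] ->.
  split; apply/forallP => a; rewrite /row_len -?rwf !ffunE -?val_eqE /= ?fv //.
  exact: col_lt.
have [f fP] := fin_all_exists (fun a => cell_ex sumla (lt_h a)).
have rwf : rw [ffun a => f a] = g.
  by apply/ffunP => a; apply/val_inj; rewrite !ffunE /= (fP a).1.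
exists [ffun a => f a].
  rewrite inE rwf eqxx andbT.
  apply/andP; split; apply/forallP => a; rewrite !ffunE.
    by rewrite (fP _).1 (fP a).1 (eqP (gu a)).
  by rewrite (fP _).2 (fP a).2 (eqP (hv a)).
by apply/ffunP => a; apply/val_inj; rewrite !ffunE /= (fP a).2.
Qed.

End Fillings.

(** * Multirectangular diagrams *)

Section Colours.

Variables (m : nat) (p : m.-tuple nat).

(** Rows of different colours may have the same length, so the colours of the
rows are not determined by the diagram and are listed apart. *)
Definition row_colours : seq 'I_m :=
  flatten [seq nseq (tnth p i) i | i <- enum 'I_m].

Lemma rect_partE (q : m.-tuple nat) :
  rect_part p q = [seq tnth q i | i <- row_colours].
Proof.
rewrite /rect_part /row_colours map_flatten -map_comp; congr flatten.
by apply: eq_map => i /=; rewrite map_nseq.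
Qed.

Lemma count_row_colours (i : 'I_m) :
  #|[set r : 'I_(size row_colours) | tnth (in_tuple row_colours) r == i]| =
  tnth p i.
Proof.
rewrite -sum1dep_card -(big_tnth _ _ _ (pred1 i) (fun=> 1%N)) sum1_count.
rewrite /row_colours count_flatten -map_comp sumnE big_map big_enum /=.
rewrite (bigD1 i) //= count_nseq /= eqxx mul1n big1 ?addn0 // => j ne_ji.
by rewrite count_nseq /= (negPf ne_ji).
Qed.

End Colours.

Section RectangularShape.

Variables (m : nat) (p q : m.-tuple nat).
Hypothesis q_dec :
  forall i j : 'I_m, (i <= j)%N -> (tnth q j <= tnth q i)%N.

Local Notation K := (in_tuple (row_colours p)).

(** Each cycle of colour i can be sent to any of the p_i rows of that colour. *)
Lemma sum_rows_by_colour (k : nat) (u : 'S_k)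
    (G : {ffun 'I_k -> 'I_m} -> algC) :
  \sum_(g : {ffun 'I_k -> 'I_(size (row_colours p))} |
          [forall a, g (u a) == g a]) G [ffun a => tnth K (g a)] =
  \sum_(phi : {ffun cycle_of u -> 'I_m})
    (\prod_b (tnth p (phi b))%:R) * G [ffun a => phi (cycle_at u a)].
Proof.
rewrite sum_invariant.
rewrite (partition_big (fun g : {ffun cycle_of u -> _} =>
                          [ffun b => tnth K (g b)]) predT) //=.
apply: eq_bigr => phi _.
under [in RHS]eq_bigr => b _ do
  rewrite -count_row_colours -sum1dep_card natr_sum.
rewrite bigA_distr_big_dep mulr_suml; apply: eq_big => [g|g /eqP <-].
  apply/eqP/familyP => [<- b|gP]; first by rewrite unfold_in ffunE.
  by apply/ffunP => b; rewrite ffunE; apply/eqP/gP.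
rewrite big1 // mul1r; congr G; apply/ffunP => a.
by rewrite !ffunE.
Qed.

(** The shortest of the rows met by c is that of the largest colour. *)
Lemma count_below_colours (k n : nat) (psi : 'I_k -> 'I_m) (c : {set 'I_k}) :
  c != set0 -> (forall i, tnth q i <= n)%N ->
  #|[set x : 'I_n | [forall (a | a \in c), x < tnth q (psi a)]%N]| =
  nth 0%N q (\max_(a in c) psi a).
Proof.
case/set0Pn => a0 a0c q_le.
have [a ac max_a] : {a | a \in c & \max_(a in c) psi a = psi a :> nat}.
  by apply: eq_bigmax_cond; rewrite (cardD1 a0) a0c.
rewrite max_a -tnth_nth.
transitivity #|[set widen_ord (q_le (psi a)) x | x : 'I_(tnth q (psi a))]|.
  apply: eq_card => x; rewrite inE.
  apply/forall_inP/imsetP => [ltx|[y _ -> b bc]].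
    by exists (Ordinal (ltx a ac)) => //; apply/val_inj.
  apply: leq_trans (ltn_ord y) _; apply: q_dec; rewrite -max_a.
  exact: (leq_bigmax_cond (F := fun a => psi a : nat)).
by rewrite card_imset ?card_ord //; apply: widen_inj.
Qed.

Lemma count_fillings_rect (k n : nat) (u v : 'S_k) :
  sumn (rect_part p q) = n -> (forall i, tnth q i <= n)%N ->
  \sum_(f : {ffun 'I_k -> 'I_n} |
     [forall a, reshape_index (rect_part p q) (f (u a))
                == reshape_index (rect_part p q) (f a)] &&
     [forall a, reshape_offset (rect_part p q) (f (v a))
                == reshape_offset (rect_part p q) (f a)]) 1 =
  \sum_(phi : {ffun cycle_of u -> 'I_m})
    (\prod_b (tnth p (phi b))%:R) *
    \prod_(c in porbits v)
      (nth 0%N q (\max_(a in c) phi (cycle_at u a)))%:R :> algC.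
Proof.
move=> sumla q_le; have size_la : size (rect_part p q) = size (row_colours p).
  by rewrite rect_partE size_map.
have nth_la (r : 'I_(size (row_colours p))) :
    nth 0%N (rect_part p q) r = tnth q (tnth K r).
  rewrite rect_partE (nth_map (tnth K r)) ?ltn_ord //; congr (tnth q _).
  exact: set_nth_default.
pose G (psi : {ffun 'I_k -> 'I_m}) : algC :=
  \prod_(c in porbits v) (nth 0%N q (\max_(a in c) psi a))%:R.
transitivity (\sum_(phi : {ffun cycle_of u -> 'I_m})
  (\prod_b (tnth p (phi b))%:R) * G [ffun a => phi (cycle_at u a)]); last first.
  apply: eq_bigr => phi _; congr (_ * _); apply: eq_bigr => c _.
  by congr (nth 0%N q _)%:R; apply: eq_bigr => a _; rewrite ffunE.
rewrite (count_fillings sumla size_la) -sum_rows_by_colour.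
apply: eq_bigr => g _.
rewrite (sum_invariant_prod v
  (fun a (x : 'I_n) => x < nth 0 (rect_part p q) (g a))%N).
apply: eq_bigr => c /imsetP[a0 _ def_c]; congr _%:R.
rewrite -(count_below_colours _ _ q_le); last first.
  by apply/set0Pn; exists a0; rewrite def_c porbit_id.
apply: eq_card => x; rewrite !inE; apply: eq_forallb => a.
by rewrite nth_la ffunE.
Qed.

End RectangularShape.

Unset Implicit Arguments.
Set Strict Implicit.

Theorem theorem1 (k m n : nat) (k_gt0 : (0 < k)%N) (m_gt0 : (0 < m)%N)
    (mu : 'S_k) (p q : m.-tuple nat)
    (p_gt0 : forall i : 'I_m, (0 < tnth p i)%N)
    (q_gt0 : forall i : 'I_m, (0 < tnth q i)%N)
    (q_dec : forall i j : 'I_m, (i <= j)%N -> (tnth q j <= tnth q i)%N)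
    (def_n : n = (\sum_(i < m) tnth p i * tnth q i)%N)
    (lekn : (k <= n)%N) :
  normalised_char lekn (rect_part p q) mu =
  (-1) ^+ k *
  \sum_(sphi : coloured_perm k m)
    ((\prod_(b : cycle_of (tag sphi)) (tnth p (tagged sphi b))%:R) *
     (\prod_(c in porbits (mu * tag sphi)%g)
        - (nth 0%N q (top_colour sphi c))%:R)).
Proof.
have sumla : sumn (rect_part p q) = n.
  rewrite def_n.
  by case/and3P: (rect_part_is_partition p q_gt0 q_dec) => _ _ /eqP.
have q_le i : (tnth q i <= n)%N.
  rewrite def_n (bigD1 i) //= (leq_trans _ (leq_addr _ _)) //.
  by rewrite leq_pmull.
rewrite normalised_char_fillings //.
rewrite (exchange_big_dep predT) //= mulr_sumr.
rewrite -(sig_big_dep xpredT (fun _ => xpredT)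
  (fun (u : 'S_k) (phi : {ffun cycle_of u -> 'I_m}) =>
    let sphi := Tagged (fun s : 'S_k => {ffun cycle_of s -> 'I_m}) phi in
    (-1) ^+ k * (\prod_(b : cycle_of u) (tnth p (phi b))%:R *
      \prod_(c in porbits (mu * u)%g) - (nth 0%N q (top_colour sphi c))%:R)))
  /=.
apply: eq_bigr => u _.
have signE (v : 'S_k) : (-1) ^+ v = (-1) ^+ k * (-1) ^+ #|porbits v| :> algC.
  rewrite -(signr_odd _ k) -(signr_odd _ #|porbits v|) -signr_addb.
  by rewrite /odd_perm card_ord.
under eq_bigr do rewrite -[(-1) ^+ _]mulr1.
rewrite -mulr_sumr (count_fillings_rect q_dec u (mu * u)%g sumla q_le).
rewrite mulr_sumr.
apply: eq_bigr => phi _; rewrite signE -mulrA; congr (_ * _).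
by rewrite [in RHS]prodrN mulrCA.
Qed.
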